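(* Let $N\ge 2$. The convex hull $\mathcal P_N^{\mathrm{Sch}}=\mathrm{conv}\{\mathsf g_w: w\in S_N\}$ in $\mathbb R^{\mathcal I_N}$ of the Schubert vertices is integrally unimodularly equivalent (with respect to the lattice $\mathbb Z^{\mathcal I_N}$) to the product of standard simplices $$\Delta_1\times\Delta_2\times\cdots\times\Delta_{N-1}.$$ Its lattice points are exactly its $N!$ vertices $\mathsf g_w$, $w\in S_N$.
   Context: Permutations $w\in S_N$ are written in one-line notation $w=(w_1,\dots,w_N)$. The inversion-end code of $w$ is $e_j(w)=\#\{i<j: w_i>w_j\}$ for $1\le j\le N$. Put $\mathcal I_N=\{(a,r)\in\mathbb Z_{>0}^2: a+r\le N\}$. The Schubert vertex $\mathsf g_w\in\mathbb Z^{\mathcal I_N}$ is $$\mathsf g_w(a,r)=\mathbf 1_{\{e_{a+r}(w)=r\}}-\mathbf 1_{\{e_{a+r+1}(w)=r\}},$$ where an out-of-range indicator (that is, one with index $a+r+1=N+1$) is zero. The standard simplex $\Delta_{m}$ is the convex hull of $0$ and the standard basis vectors in $\mathbb R^m$, with lattice $\mathbb Z^m$. Two lattice polytopes are integrally unimodularly equivalent if a lattice isomorphism of the ambient lattices carries one to the other. *)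

(* Defs.v *)
From HB Require Import structures.
From mathcomp Require Import all_boot all_order all_algebra all_fingroup.
From mathcomp Require Import boolp classical_sets cardinality reals convex.

Set Implicit Arguments.
Unset Strict Implicit.
Unset Printing Implicit Defensive.

Import Order.TTheory GRing.Theory Num.Theory.
Local Open Scope classical_set_scope.
Local Open Scope ring_scope.

(* The real vector space with coordinates indexed by I is {ffun I -> R^o}, where
   R^o is R as a module over itself; its lattice is the image under [intvec] of
   {ffun I -> int}. *)
Definition intvec (R : realType) (I : finType) (x : {ffun I -> int}) :
    {ffun I -> R^o} :=
  [ffun i => (x i)%:~R].

Definition lattice (R : realType) (I : finType) : set {ffun I -> R^o} :=
  range (@intvec R I).
Arguments lattice : clear implicits.

Definition convex_hull (R : realType) (V : lmodType R) (A : set V) : set V :=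
  smallest (@convex_set R V) A.

(* The vertices are the 0-dimensional faces: the points x of P at which some
   linear functional attains its maximum over P, and attains it only there. *)
Definition vertices (R : realType) (I : finType) (P : set {ffun I -> R^o}) :
    set {ffun I -> R^o} :=
  [set x | P x /\ exists c : {ffun I -> R^o},
    forall y, P y -> y != x -> \sum_i c i * y i < \sum_i c i * x i].

(* F is the R-linear extension of the lattice isomorphism f; it is unique,
   since the lattice spans the space. *)
Definition unimodularly_equivalent (R : realType) (I J : finType)
    (P : set {ffun I -> R^o}) (Q : set {ffun J -> R^o}) : Prop :=
  exists (f : {additive {ffun I -> int} -> {ffun J -> int}})
         (F : {linear {ffun I -> R^o} -> {ffun J -> R^o}}),
    [/\ bijective f,
        forall x, F (intvec R x) = intvec R (f x) &
        F @` P = Q].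

Definition std_basis (R : realType) (m : nat) (i : 'I_m) : {ffun 'I_m -> R^o} :=
  [ffun k => (k == i)%:R].

Definition std_simplex (R : realType) (m : nat) : set {ffun 'I_m -> R^o} :=
  convex_hull (0 |` range (@std_basis R m)).
Arguments std_simplex : clear implicits.

(* The k-th factor, k < N - 1, is the simplex of dimension k + 1. The ambient
   space R^1 x ... x R^(N-1) is realized with the disjoint union of the index
   sets of the factors as its set of coordinates. *)
Definition simplex_coords (N : nat) : finType := {k : 'I_N.-1 & 'I_k.+1}.

Definition block (R : realType) (N : nat)
    (x : {ffun simplex_coords N -> R^o}) (k : 'I_N.-1) : {ffun 'I_k.+1 -> R^o} :=
  [ffun i => x (Tagged (fun k : 'I_N.-1 => 'I_k.+1) i)].

Definition simplex_product (R : realType) (N : nat) :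
    set {ffun simplex_coords N -> R^o} :=
  [set x | forall k : 'I_N.-1, std_simplex R k.+1 (block x k)].
Arguments simplex_product : clear implicits.

(* In 'S_N positions and values are numbered from 0, so the code entry e_j is
   [inv_end_code w j'] with j = j' + 1. *)
Definition inv_end_code (N : nat) (w : 'S_N) (j : 'I_N) : nat :=
  #|[set i : 'I_N | (i < j)%N && (w j < w i)%N]%SET|.

(* The indicator of e_j(w) = r, where j is numbered from 1; it is 0 when j is
   not in {1, ..., N}. *)
Definition code_indicator (N : nat) (w : 'S_N) (j r : nat) : int :=
  [exists k : 'I_N, (k.+1 == j) && (inv_end_code w k == r)]%:R.

(* The pairs (a, r) of positive integers with a + r <= N. *)
Definition schubert_index (N : nat) : finType :=
  {p : 'I_N.+1 * 'I_N.+1 | [&& 0 < p.1, 0 < p.2 & p.1 + p.2 <= N]%N}.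

Definition schubert_vertex (N : nat) (w : 'S_N) :
    {ffun schubert_index N -> int} :=
  [ffun p : schubert_index N =>
     let a : nat := (val p).1 in
     let r : nat := (val p).2 in
     code_indicator w (a + r) r - code_indicator w (a + r).+1 r].

Definition schubert_vertices (R : realType) (N : nat) :
    set {ffun schubert_index N -> R^o} :=
  [set intvec R (schubert_vertex w) | w in [set: 'S_N]].
Arguments schubert_vertices : clear implicits.

Definition schubert_polytope (R : realType) (N : nat) :
    set {ffun schubert_index N -> R^o} :=
  convex_hull (schubert_vertices R N).
Arguments schubert_polytope : clear implicits.

(* Main.v *)
From HB Require Import structures.
Require Import Defs.
From mathcomp Require Import all_boot all_order all_algebra all_fingroup.
From mathcomp Require Import interval_inference.
From mathcomp Require Import boolp classical_sets cardinality reals convex.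

(** Place the coordinates of both spaces at the positions (j, r) with
    0 < r < j <= N. A Schubert vertex is then the difference
    X (j, r) - X (j + 1, r), where X (j, r) is the indicator of e_j(w) = r and
    X (N + 1, r) = 0. Summing over the first index, from j up to N, recovers X;
    this summation is a lattice isomorphism, with inverse given by the
    differences (simplex_of_schubertK, schubert_of_simplexK), and it sends the
    Schubert vertex of w to the point whose j-th block is the basis vector
    numbered e_j(w), or 0 when e_j(w) = 0.

    The code w |-> (e_1(w), ..., e_N(w)) is a bijection onto the sequences with
    e_j < j: it is injective (inv_end_code_inj), and both sides have N!
    elements (inv_end_code_onto). Hence the images of the Schubert vertices are
    all the points each of whose blocks is 0 or a basis vector
    (vertex_blocksP). The convex hull of these points is the whole product of
    simplices, since the blocks can be moved one at a time from vertices to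
    arbitrary points of their simplices (simplex_product_sub).

    What remains is checked on the product of simplices. In a standard simplex
    the coordinates are nonnegative with sum at most 1, so a lattice point is 0
    or a basis vector (std_simplex_lattice). A point x with coordinates in
    {0, 1} is the only maximum over the unit cube of the functional with
    coefficients 2 x_i - 1, which makes it a vertex (vertex_blocks_vertices).
    Conversely a vertex of a convex hull is one of the generating points
    (vertices_hull_sub). *)

(** * The inversion-end code *)

Section InversionEndCode.
Variable N : nat.
Implicit Types (w : 'S_N) (j : 'I_N).

Lemma inv_end_code_le w j : (inv_end_code w j <= j)%N.
Proof.
have -> : (j : nat) = #|[set i : 'I_N | (i < j)%N]%SET|.
  rewrite cardsE -sum1_card -(big_ord_widen N (fun=> 1%N) (ltnW (ltn_ord j))).
  by rewrite sum1_card card_ord.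
by apply/subset_leq_card/fintype.subsetP => i; rewrite !inE => /andP[].
Qed.

(** Among the values taken at the positions up to j, the code entry e_j
    counts those exceeding w_j. *)
Lemma inv_end_codeE w j :
  inv_end_code w j =
  #|[set v in w @: [set i : 'I_N | (i <= j)%N] | (w j < v)%N]%SET|.
Proof.
rewrite /inv_end_code -[LHS](card_imset _ (@perm_inj _ w)); apply: eq_card => v.
rewrite !inE; apply/finset.imsetP/andP => [[i]|[/finset.imsetP[i]]].
  rewrite inE => /andP[lt_ij lt_w ->]; split=> //.
  by rewrite finset.imset_f // inE ltnW.
rewrite inE leq_eqVlt => /orP[/eqP/val_inj -> ->|lt_ij ->]; rewrite ?ltnn //.
by move=> lt_w; exists i; rewrite // inE lt_ij.
Qed.

(** The values taken at the positions up to j are those not taken after j. *)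
Lemma initial_values_sub w w' j : (forall i : 'I_N, (j < i)%N -> w i = w' i) ->
  w @: [set i : 'I_N | (i <= j)%N]%SET \subset
  w' @: [set i : 'I_N | (i <= j)%N]%SET.
Proof.
move=> eqw; apply/fintype.subsetP => v /finset.imsetP[i]; rewrite inE => le_ij ->{v}.
apply/finset.imsetP; exists ((w'^-1)%g (w i)); last by rewrite permKV.
rewrite inE leqNgt; apply/negP => lt_j.
have := eqw _ lt_j; rewrite permKV => /perm_inj eqi.
by rewrite eqi ltnNge le_ij in lt_j.
Qed.

(** The entries w_j are recovered from the code by descending induction on j:
    once the entries after j are known, so is the set of values taken up to j,
    and w_j is the element of that set exceeded by exactly e_j others. *)
Lemma inv_end_code_inj w w' : inv_end_code w =1 inv_end_code w' -> w = w'.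
Proof.
move=> eqe; apply/permP => j.
have [m] := ubnP (N - j); elim: m j => // m IHm j; rewrite ltnS => le_m.
have above (i : 'I_N) : (j < i)%N -> w i = w' i.
  move=> lt_ji; apply: IHm; apply: leq_trans le_m.
  by apply: ltn_sub2l => //; apply: ltn_ord.
have eqA : w @: [set i : 'I_N | (i <= j)%N]%SET
           = w' @: [set i : 'I_N | (i <= j)%N]%SET.
  by apply/eqP; rewrite finset.eqEsubset !initial_values_sub // => i /above.
have := eqe j; rewrite !inv_end_codeE -eqA.
set A := (w @: _)%SET.
have count_lt (u v : 'I_N) : v \in A -> (u < v)%N ->
  (#|[set x in A | (v < x)%N]%SET| < #|[set x in A | (u < x)%N]%SET|)%N.
  move=> Av lt_uv; apply/proper_card/fintype.properP; split.
    apply/fintype.subsetP => x; rewrite !inE => /andP[-> /=].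
    exact: ltn_trans.
  by exists v; rewrite !inE ?Av ?ltnn.
have Aw : w j \in A by rewrite finset.imset_f // inE.
have Aw' : w' j \in A by rewrite /A eqA finset.imset_f // inE.
move=> eqc; apply/val_inj.
case: (ltngtP (w j) (w' j)) => // [/(count_lt _ _ Aw')|/(count_lt _ _ Aw)];
  by rewrite eqc ltnn.
Qed.

Lemma inv_end_code_onto (m : 'I_N -> nat) : (forall j, (m j <= j)%N) ->
  exists w, inv_end_code w =1 m.
Proof.
(* e_j(w) <= j for positions j numbered from 0, so a code is a dependent
   function with j-th value in 'I_j.+1; there are N! of them. *)
move=> le_m.
pose code w : {dffun forall j : 'I_N, 'I_j.+1} :=
  [ffun j => inord (inv_end_code w j)].
have codeE w j : code w j = inv_end_code w j :> nat.
  by rewrite ffunE inordK // ltnS inv_end_code_le.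
have code_inj : injective code.
  move=> w w' /ffunP eqc; apply: inv_end_code_inj => j.
  by rewrite -!codeE eqc.
have card_codes : #|{dffun forall j : 'I_N, 'I_j.+1}| = #|{: 'S_N}|.
  rewrite card_dep_ffun card_Sn fact_prod big_add1 big_mkord.
  rewrite foldrE big_map big_enum /=; apply: eq_bigr => j _.
  by rewrite card_ord.
pose c : {dffun forall j : 'I_N, 'I_j.+1} := [ffun j => inord (m j)].
have /codomP[w cw] : c \in codom code.
  by apply: inj_card_onto; rewrite // card_codes.
exists w => j; rewrite -codeE -cw ffunE inordK // ltnS.
exact: le_m.
Qed.

End InversionEndCode.

(** * Entries of vectors by position *)

Section Entry.
Local Set Implicit Arguments.
Local Unset Strict Implicit.
Local Open Scope ring_scope.
Import GRing.Theory.

(** The entry of y at the position q, when the positions of its coordinates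
    are given by h; it is 0 at a position occupied by no coordinate. *)
Definition entry (I : finType) (h : I -> nat * nat) (V : zmodType)
    (y : {ffun I -> V}) (q : nat * nat) : V :=
  \sum_(i | h i == q) y i.

Variables (I : finType) (h : I -> nat * nat).

Lemma entryE (V : zmodType) (y : {ffun I -> V}) i : injective h ->
  entry h y (h i) = y i.
Proof. by move=> inj_h; rewrite /entry (big_pred1 i) // => k; rewrite /= inj_eq. Qed.

Lemma entry_out (V : zmodType) (y : {ffun I -> V}) q :
  (forall i, h i <> q) -> entry h y q = 0.
Proof. by move=> hq; rewrite /entry big_pred0 // => i; apply/eqP. Qed.

Lemma entryB (V : zmodType) (x y : {ffun I -> V}) q :
  entry h (x - y) q = entry h x q - entry h y q.
Proof. by rewrite /entry -sumrB; apply: eq_bigr => i _; rewrite !ffunE. Qed.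

Lemma entryZ (R : pzRingType) (V : lmodType R) (a : R) (y : {ffun I -> V}) q :
  entry h (a *: y) q = a *: entry h y q.
Proof. by rewrite /entry scaler_sumr; apply: eq_bigr => i _; rewrite ffunE. Qed.

Lemma entry_map (V W : zmodType) (g : {additive V -> W}) (y : {ffun I -> V}) q :
  entry h [ffun i => g (y i)] q = g (entry h y q).
Proof. by rewrite /entry raddf_sum; apply: eq_bigr => i _; rewrite ffunE. Qed.

End Entry.

(** * The lattice isomorphism *)

Section Coordinates.
Local Set Implicit Arguments.
Local Unset Strict Implicit.
Local Open Scope ring_scope.
Import GRing.Theory.
Variable N : nat.

(** Coordinates of both spaces are placed at the positions (j, r) with
    0 < r < j <= N: the index (a, r) at (a + r, r), and the i-th coordinate of
    the k-th simplex, which has dimension k + 1, at (k + 2, i + 1). *)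
Definition schubert_pos (p : schubert_index N) : nat * nat :=
  ((val p).1 + (val p).2, (val p).2 : nat)%N.

Definition simplex_pos (u : simplex_coords N) : nat * nat :=
  ((tag u).+2, (tagged u : nat).+1).

Lemma schubert_pos_inj : injective schubert_pos.
Proof.
move=> p q [/eqP]; move=> + eqr; rewrite eqr eqn_add2r => /eqP eqa.
by apply/val_inj/eqP; rewrite -pair_eqE /= -!val_eqE /= eqa eqr !eqxx.
Qed.

Lemma simplex_pos_inj : injective simplex_pos.
Proof.
move=> [k i] [l m] [/val_inj]; rewrite /tag /tagged /= => eqk.
by rewrite -{}eqk in m * => /val_inj ->.
Qed.

Lemma simplex_posP j r : (0 < r < j)%N -> (j <= N)%N ->
  exists u, simplex_pos u = (j, r).
Proof.
case: j r => [|[|k]] [|i] //; rewrite ?ltnS => lt_ik lt_kN.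
have lt_k : (k < N.-1)%N by case: (N) lt_kN.
by exists (Tagged (fun k : 'I_N.-1 => 'I_k.+1)
                  (@Ordinal (Ordinal lt_k).+1 i lt_ik)).
Qed.

Lemma schubert_posP j r : (0 < r < j)%N -> (j <= N)%N ->
  exists p, schubert_pos p = (j, r).
Proof.
move=> /andP[r_gt0 lt_rj] le_jN.
have lt_r : (r < N.+1)%N by rewrite ltnS (leq_trans (ltnW lt_rj)).
have lt_a : (j - r < N.+1)%N by rewrite ltnS (leq_trans (leq_subr _ _)).
have ok : [&& 0 < Ordinal lt_a, 0 < Ordinal lt_r
             & Ordinal lt_a + Ordinal lt_r <= N]%N.
  by rewrite /= subn_gt0 lt_rj r_gt0 subnK // ltnW.
exists (Sub (Ordinal lt_a, Ordinal lt_r) ok).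
by rewrite /schubert_pos /= subnK // ltnW.
Qed.

Lemma schubert_pos_range p :
  (0 < (schubert_pos p).2 < (schubert_pos p).1)%N
  && ((schubert_pos p).1 <= N)%N.
Proof.
case/and3P: (valP p) => a_gt0 r_gt0 le_N.
by rewrite /= r_gt0 -addn1 addnC leq_add2r a_gt0.
Qed.

Lemma simplex_pos_range u :
  (0 < (simplex_pos u).2 < (simplex_pos u).1)%N
  && ((simplex_pos u).1 <= N)%N.
Proof.
rewrite /= !ltnS leq_ord /=.
by have := ltn_ord (tag u); case: (N) (tag u) => [[] //|n k].
Qed.

(** The entry at (j, r) becomes the sum of the entries at (j', r) for
    j <= j' <= N. *)
Definition simplex_of_schubert (V : zmodType)
    (y : {ffun schubert_index N -> V}) : {ffun simplex_coords N -> V} :=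
  [ffun u => \sum_((simplex_pos u).1 <= j < N.+1)
               entry schubert_pos y (j, (simplex_pos u).2)].

(** The entry at (j, r) becomes its difference with the one at (j + 1, r),
    which is 0 by convention when j = N. *)
Definition schubert_of_simplex (V : zmodType)
    (x : {ffun simplex_coords N -> V}) : {ffun schubert_index N -> V} :=
  [ffun p => entry simplex_pos x ((schubert_pos p).1, (schubert_pos p).2)
    - entry simplex_pos x ((schubert_pos p).1.+1, (schubert_pos p).2)].

Lemma simplex_of_schubertK (V : zmodType) :
  cancel (@simplex_of_schubert V) (@schubert_of_simplex V).
Proof.
move=> y; apply/ffunP => p; rewrite ffunE.
have /andP[lt_rj le_jN] := schubert_pos_range p.
have sumE j r : (0 < r < j)%N -> entry simplex_pos (simplex_of_schubert y) (j, r)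
    = \sum_(j <= i < N.+1) entry schubert_pos y (i, r).
  move=> lt_r; case: (leqP j N) => [le_j|lt_N].
    have [u uE] := simplex_posP lt_r le_j.
    by rewrite -uE entryE ?ffunE ?uE //; apply: simplex_pos_inj.
  rewrite big_geq // entry_out // => u uE.
  have := simplex_pos_range u; rewrite uE /= => /andP[_].
  by rewrite leqNgt lt_N.
rewrite !sumE //; last by case/andP: lt_rj => -> /= /ltnW.
rewrite big_ltn ?ltnS // addrK -surjective_pairing entryE //.
exact: schubert_pos_inj.
Qed.

Lemma schubert_of_simplexK (V : zmodType) :
  cancel (@schubert_of_simplex V) (@simplex_of_schubert V).
Proof.
move=> x; apply/ffunP => u; rewrite ffunE.
have /andP[/andP[r_gt0 lt_rj] le_jN] := simplex_pos_range u.
set r := (simplex_pos u).2.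
rewrite (telescope_sumr_eq (fun j => - entry simplex_pos x (j, r))).
- rewrite entry_out ?oppr0 ?add0r ?opprK.
    by rewrite -surjective_pairing entryE //; apply: simplex_pos_inj.
  move=> v vE; have := simplex_pos_range v.
  by rewrite vE /= ltnn andbF.
- exact: leqW.
move=> j /andP[le_j]; rewrite ltnS => lt_j.
have lt_r : (0 < r < j)%N by rewrite r_gt0 (leq_trans lt_rj).
have [p pE] := schubert_posP lt_r lt_j.
rewrite -pE entryE ?ffunE ?pE; last exact: schubert_pos_inj.
by rewrite opprK addrC.
Qed.

Lemma simplex_of_schubert_zmod (V : zmodType) :
  zmod_morphism (@simplex_of_schubert V).
Proof.
move=> x y; apply/ffunP => u; rewrite !ffunE -sumrB.
by apply: eq_bigr => j _; rewrite entryB.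
Qed.

HB.instance Definition _ (V : zmodType) :=
  GRing.isZmodMorphism.Build _ _ (@simplex_of_schubert V)
    (@simplex_of_schubert_zmod V).

Lemma simplex_of_schubert_scalable (R : pzRingType) (V : lmodType R) :
  scalable (@simplex_of_schubert V).
Proof.
move=> a x; apply/ffunP => u; rewrite !ffunE scaler_sumr.
by apply: eq_bigr => j _; rewrite entryZ.
Qed.

HB.instance Definition _ (R : pzRingType) (V : lmodType R) :=
  GRing.isScalable.Build R _ _ _ (@simplex_of_schubert V)
    (@simplex_of_schubert_scalable R V).

Lemma simplex_of_schubert_map (V W : zmodType) (g : {additive V -> W})
    (y : {ffun schubert_index N -> V}) :
  simplex_of_schubert [ffun p => g (y p)] = [ffun u => g (simplex_of_schubert y u)].
Proof.
apply/ffunP => u; rewrite !ffunE raddf_sum; apply: eq_bigr => j _.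
by rewrite entry_map.
Qed.

End Coordinates.

(** * Convex hulls, their vertices, and standard simplices *)

Section Convexity.
Local Set Implicit Arguments.
Local Unset Strict Implicit.
Local Open Scope ring_scope.
Local Open Scope classical_set_scope.
Import Order.TTheory GRing.Theory Num.Theory.
Variable R : realType.
Implicit Types (U V : lmodType R) (I J : finType).

Lemma convex_setP V (A : set V) :
  @convex_set R V A <->
  forall (t : R) x y, 0 <= t -> t <= 1 -> A x -> A y -> A (t *: x + (1 - t) *: y).
Proof.
split=> [cA t x y t0 t1 /mem_set Ax /mem_set Ay|cA x y t /set_mem Ax /set_mem Ay].
  exact/set_mem/(cA x y (Itv01 t0 t1)).
by apply/mem_set/cA.
Qed.

Lemma convex_hull_convex V (A : set V) : @convex_set R V (convex_hull A).
Proof.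
apply/convex_setP => t x y t0 t1 Ax Ay B [cB sAB].
have /convex_setP := cB; apply=> //; [exact: Ax|exact: Ay].
Qed.

Lemma image_convex_set U V (F : {linear U -> V}) (A : set U) :
  @convex_set R U A -> @convex_set R V (F @` A).
Proof.
move=> /convex_setP cA; apply/convex_setP => t _ _ t0 t1 [x Ax <-] [y Ay <-].
by exists (t *: x + (1 - t) *: y); [apply: cA|rewrite linearD !linearZ].
Qed.

(** If x is not in S, the open half-space on which the functional is below its
    value at x is convex and contains S, hence it contains x: a contradiction. *)
Lemma vertices_hull_sub I (S : set {ffun I -> R^o}) :
  vertices (convex_hull S) `<=` S.
Proof.
move=> x [Px [c max_x]]; apply: contrapT => nSx.
have : convex_hull S `<=` [set y | \sum_i c i * y i < \sum_i c i * x i].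
  apply: smallest_sub => [|y Sy]; last first.
    apply: max_x; first exact: sub_gen_smallest.
    by apply/eqP => yx; rewrite yx in Sy.
  apply/convex_setP => t y z t0 t1; rewrite /= => lt_y lt_z.
  have -> : \sum_i c i * (t *: y + (1 - t) *: z) i =
      t * (\sum_i c i * y i) + (1 - t) * (\sum_i c i * z i).
    rewrite !mulr_sumr -big_split /=; apply: eq_bigr => i _.
    rewrite !ffunE mulrDr; congr (_ + _); exact: mulrCA.
  have <- : t * (\sum_i c i * x i) + (1 - t) * (\sum_i c i * x i) = \sum_i c i * x i.
    by rewrite -mulrDl subrKC mul1r.
  have [->|t_neq0] := eqVneq t 0; first by rewrite !mul0r !add0r subr0 !mul1r.
  apply: ltr_leD; first by rewrite ltr_pM2l // lt_def t_neq0.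
  by rewrite ler_wpM2l ?subr_ge0 // ltW.
by move=> /(_ x Px) /=; rewrite ltxx.
Qed.

Lemma vertices_linear_preimage I J
    (F : {linear {ffun I -> R^o} -> {ffun J -> R^o}})
    (P : set {ffun I -> R^o}) (x : {ffun I -> R^o}) :
  injective F -> P x -> vertices (F @` P) (F x) -> vertices P x.
Proof.
move=> inj_F Px [_ [c max_x]]; split=> //.
pose e i : {ffun I -> R^o} := [ffun k => (k == i)%:R].
(* The functional c composed with F, in coordinates. *)
exists [ffun i => \sum_j c j * F (e i) j].
have pullback (y : {ffun I -> R^o}) :
    \sum_i [ffun i => \sum_j c j * F (e i) j] i * y i = \sum_j c j * F y j.
  have {2}-> : y = \sum_i y i *: e i.
    apply/ffunP => k; rewrite sum_ffunE (bigD1 k) //= big1 => [|i neq_ik].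
      by rewrite !ffunE eqxx addr0 [RHS]mulr1.
    by rewrite !ffunE eq_sym (negPf neq_ik); apply: mulr0.
  under eq_bigr do rewrite ffunE mulr_suml.
  rewrite exchange_big; apply: eq_bigr => j _ /=.
  rewrite linear_sum sum_ffunE mulr_sumr; apply: eq_bigr => i _.
  by rewrite linearZ !ffunE -mulrA; congr (_ * _); apply: mulrC.
move=> y Py neq_yx; rewrite !pullback; apply: max_x; first by exists y.
by rewrite inj_eq.
Qed.

Lemma intvecE I (x : {ffun I -> int}) i : intvec R x i = (x i)%:~R.
Proof. exact: ffunE. Qed.

Lemma intvec_inj I : injective (@intvec R I).
Proof.
move=> x y /ffunP eqxy; apply/ffunP => i.
by have := eqxy i; rewrite !ffunE => /intr_inj.
Qed.

Lemma std_simplex_bounds m (x : {ffun 'I_m -> R^o}) : std_simplex R m x ->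
  (forall i, 0 <= x i) /\ \sum_i x i <= 1.
Proof.
pose B := [set y : {ffun 'I_m -> R^o} | (forall i, 0 <= y i) /\ \sum_i y i <= 1].
suff sub_B : std_simplex R m `<=` B by exact: sub_B.
apply: smallest_sub => [|_ [->|[i _ <-]]].
- apply/convex_setP => t y z t0 t1 [y0 y1] [z0 z1]; split=> [i|].
    by rewrite !ffunE addr_ge0 // mulr_ge0 // subr_ge0.
  have -> : \sum_i (t *: y + (1 - t) *: z) i =
      t * (\sum_i y i) + (1 - t) * (\sum_i z i).
    by rewrite !mulr_sumr -big_split /=; apply: eq_bigr => i _; rewrite !ffunE.
  rewrite -[leRHS](subrKC t); apply: lerD.
    by rewrite ler_piMr.
  by rewrite ler_piMr ?subr_ge0.
- split=> [i|]; first by rewrite ffunE.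
  by rewrite big1 // => i _; rewrite ffunE.
split=> [k|]; first by rewrite ffunE.
rewrite (bigD1 i) //= big1 => [|k neq_ki]; first by rewrite ffunE eqxx addr0.
by rewrite ffunE (negPf neq_ki).
Qed.

Lemma std_simplex_lattice m (x : {ffun 'I_m -> int}) :
  std_simplex R m (intvec R x) -> (0 |` range (@std_basis R m)) (intvec R x).
Proof.
move=> /std_simplex_bounds[x_ge0 sum_le1].
have {}x_ge0 i : 0 <= x i by have := x_ge0 i; rewrite ffunE ler0z.
have {}sum_le1 : \sum_i x i <= 1.
  move: sum_le1; under eq_bigr do rewrite ffunE.
  by rewrite -rmorph_sum /= -[leRHS]/(1%:~R) ler_int.
case: (pickP (fun i => x i != 0)) => [i xi_neq0|x0]; last first.
  by left; apply/ffunP => i; rewrite !ffunE; move/negbFE/eqP: (x0 i) => ->.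
right; exists i => //; apply/ffunP => k; rewrite !ffunE.
have xi_ge1 : 1 <= x i by rewrite -gtz0_ge1 lt_def xi_neq0 x_ge0.
have rest_ge0 : 0 <= \sum_(l | l != i) x l by apply: sumr_ge0.
rewrite (bigD1 i) //= in sum_le1.
have rest0 : \sum_(l | l != i) x l = 0.
  apply/eqP; rewrite eq_le rest_ge0 andbT -(lerD2l 1) addr0.
  by apply: le_trans sum_le1; rewrite lerD2r.
have [->|neq_ki] := eqVneq k i; last first.
  by rewrite (psumr_eq0P _ rest0).
rewrite rest0 addr0 in sum_le1.
by have -> : x i = 1 by apply/eqP; rewrite eq_le sum_le1.
Qed.

End Convexity.

(** * The product of simplices *)

Section Product.
Local Set Implicit Arguments.
Local Unset Strict Implicit.
Local Open Scope ring_scope.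
Local Open Scope classical_set_scope.
Import Order.TTheory GRing.Theory Num.Theory.
Variables (R : realType) (N : nat).
Implicit Types x y : {ffun simplex_coords N -> R^o}.

(** Each block of x is a vertex of its simplex: 0 or a basis vector. *)
Definition vertex_blocks x : Prop :=
  forall k : 'I_N.-1, (0 |` range (@std_basis R k.+1)) (block x k).

Lemma vertex_blocks_simplex x : vertex_blocks x -> simplex_product R N x.
Proof. by move=> vx k; apply: sub_gen_smallest; apply: vx. Qed.

Lemma blockE x u : x u = block x (tag u) (tagged u).
Proof. by case: u => k i; rewrite ffunE. Qed.

Lemma simplex_product_convex : convex_set (simplex_product R N).
Proof.
apply/convex_setP => t x y t0 t1 Qx Qy k.
have -> : block (t *: x + (1 - t) *: y) k = t *: block x k + (1 - t) *: block y k.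
  by apply/ffunP => i; rewrite !ffunE.
have /convex_setP cD := @convex_hull_convex R _ (0 |` range (@std_basis R k.+1)).
exact: (cD t _ _ t0 t1 (Qx k) (Qy k)).
Qed.

(** The point x with its k-th block replaced by z. *)
Definition replace_block x (k : 'I_N.-1) (z : {ffun 'I_k.+1 -> R^o}) :
    {ffun simplex_coords N -> R^o} :=
  [ffun u : simplex_coords N =>
     if tag u == k then z (inord (tagged u : 'I_(tag u).+1)) else x u].

Lemma block_replace x (k : 'I_N.-1) (z : {ffun 'I_k.+1 -> R^o}) :
  block (replace_block x z) k = z.
Proof. by apply/ffunP => i; rewrite !ffunE /= eqxx inord_val. Qed.

Lemma block_replace_neq x (k : 'I_N.-1) (z : {ffun 'I_k.+1 -> R^o}) l : l != k ->
  block (replace_block x z) l = block x l.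
Proof. by move=> neq_lk; apply/ffunP => i; rewrite !ffunE /= (negPf neq_lk). Qed.

Lemma replace_block_id x k : replace_block x (block x k) = x.
Proof.
apply/ffunP => -[l i]; rewrite !ffunE /=.
by case: eqVneq => // eq_lk; subst l; rewrite inord_val.
Qed.

(** By induction on n, W contains the points of the product whose blocks
    numbered n and above are vertices: as a function of the n-th block alone,
    membership in W defines a convex set, which contains the vertices of the
    simplex by induction, hence the whole simplex. *)
Lemma simplex_product_sub (W : set {ffun simplex_coords N -> R^o}) :
  @convex_set R _ W -> vertex_blocks `<=` W -> simplex_product R N `<=` W.
Proof.
move=> /convex_setP cW sVW.
have main n x : simplex_product R N x ->
    (forall k : 'I_N.-1, (n <= k)%N -> (0 |` range (@std_basis R k.+1)) (block x k)) ->
    W x.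
  elim: n x => [|n IHn] x Qx vx; first by apply: sVW => k; apply: vx.
  have [le_Nn|lt_nN] := leqP N.-1 n.
    by apply: IHn => // k; rewrite leqNgt (leq_trans (ltn_ord k)).
  pose k0 := Ordinal lt_nN.
  have : std_simplex R k0.+1 `<=` [set z | W (replace_block x z)].
    apply: smallest_sub => [|z vz /=].
      apply/convex_setP => t y z t0 t1 /= Wy Wz.
      have -> : replace_block x (t *: y + (1 - t) *: z) =
          t *: replace_block x y + (1 - t) *: replace_block x z.
        apply/ffunP => u; rewrite !ffunE; case: ifP => // _.
        by rewrite -scalerDl subrKC scale1r.
      exact: cW.
    apply: IHn => k; have [->|neq_k] := eqVneq k k0.
    - by rewrite block_replace; apply: sub_gen_smallest.
    - by rewrite block_replace_neq.
    - by rewrite block_replace.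
    rewrite leq_eqVlt => /orP[/eqP eq_k|lt_k].
      by case/eqP: neq_k; apply/val_inj.
    by rewrite block_replace_neq //; apply: vx.
  by move=> /(_ _ (Qx k0)) /=; rewrite replace_block_id.
by move=> x Qx; apply: (main N.-1) => // k; rewrite leqNgt ltn_ord.
Qed.

Lemma vertex_blocks_vertices x : vertex_blocks x -> vertices (simplex_product R N) x.
Proof.
move=> vx; split; first exact: vertex_blocks_simplex.
have x01 u : x u = 0 \/ x u = 1.
  rewrite blockE; case: (vx (tag u)) => [->|[i _ <-]]; rewrite ffunE; first by left.
  by case: eqP => _; [right|left].
(* The coefficient is 1 where x u = 1 and -1 where x u = 0. *)
exists [ffun u => 2 * x u - 1] => y Qy neq_yx.
have y_ge0 u : 0 <= y u.
  by rewrite blockE; apply: (std_simplex_bounds (Qy _)).1.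
have y_le1 u : y u <= 1.
  rewrite blockE; have [b0 b1] := std_simplex_bounds (Qy (tag u)).
  apply: le_trans b1; rewrite (bigD1 (tagged u)) //= lerDl.
  by apply: sumr_ge0 => i _; apply: b0.
have gap_ge0 u : 0 <= (2 * x u - 1) * x u - (2 * x u - 1) * y u.
  rewrite -mulrBr; case: (x01 u) => ->.
    by rewrite mulr0 !sub0r mulN1r opprK.
  by rewrite mulr1 addrK mul1r subr_ge0.
under eq_bigr do rewrite ffunE.
under [ltRHS]eq_bigr do rewrite ffunE.
rewrite -subr_gt0 -sumrB lt_def sumr_ge0 ?andbT => [|u _]; last exact: gap_ge0.
apply: contra neq_yx => /eqP /psumr_eq0P gap0; apply/eqP/ffunP => u.
have := gap0 (fun u _ => gap_ge0 u) u isT; rewrite -mulrBr.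
case: (x01 u) => ->.
  by rewrite mulr0 !sub0r mulN1r opprK.
by rewrite mulr1 addrK mul1r => /eqP; rewrite subr_eq0 eq_sym => /eqP.
Qed.

End Product.

(** * The Schubert polytope *)

Section Schubert.
Local Set Implicit Arguments.
Local Unset Strict Implicit.
Local Open Scope ring_scope.
Local Open Scope classical_set_scope.
Import Order.TTheory GRing.Theory Num.Theory.
Variables (R : realType) (N : nat).

Lemma code_indicatorE (w : 'S_N) (j : 'I_N) r :
  code_indicator w j.+1 r = (inv_end_code w j == r)%:R.
Proof.
rewrite /code_indicator; congr ((nat_of_bool _)%:R).
apply/existsP/idP => [[k /andP[/eqP[/val_inj ->]] //]|eq_r].
by exists j; rewrite eqxx.
Qed.

Lemma code_indicator_out (w : 'S_N) r : code_indicator w N.+1 r = 0.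
Proof.
rewrite /code_indicator; case: existsP => // -[k /andP[/eqP[eq_k]]].
by have := ltn_ord k; rewrite eq_k ltnn.
Qed.

Lemma simplex_of_schubert_vertex (w : 'S_N) u :
  simplex_of_schubert (schubert_vertex w) u =
  code_indicator w (simplex_pos u).1 (simplex_pos u).2.
Proof.
rewrite ffunE; have /andP[/andP[r_gt0 lt_rj] le_jN] := simplex_pos_range u.
set r := (simplex_pos u).2.
rewrite (telescope_sumr_eq (fun j => - code_indicator w j r)) ?leqW //.
  by rewrite code_indicator_out oppr0 add0r opprK.
move=> j /andP[le_j]; rewrite ltnS => lt_j.
have lt_r : (0 < r < j)%N by rewrite r_gt0 (leq_trans lt_rj).
have [p pE] := schubert_posP lt_r lt_j.
rewrite -pE entryE; last exact: schubert_pos_inj.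
by case: pE => <- <-; rewrite ffunE opprK addrC.
Qed.

(** The Schubert vertex determines which of the e_j(w) equal a given r > 0,
    hence also which of them are 0. *)
Lemma schubert_vertex_inj : injective (@schubert_vertex N).
Proof.
move=> w w' eq_g; apply: inv_end_code_inj => j.
have code_eq (u : simplex_coords N) : code_indicator w (simplex_pos u).1 (simplex_pos u).2
    = code_indicator w' (simplex_pos u).1 (simplex_pos u).2.
  by rewrite -!simplex_of_schubert_vertex eq_g.
have eq_pos r : (0 < r < j.+1)%N -> (inv_end_code w j == r) = (inv_end_code w' j == r).
  move=> lt_r; have [u uE] := simplex_posP lt_r (ltn_ord j).
  have := code_eq u; rewrite uE !code_indicatorE.
  by do 2!case: (_ == r).
have [e0|e_gt0] := posnP (inv_end_code w j); last first.
  have := eq_pos (inv_end_code w j); rewrite e_gt0 ltnS inv_end_code_le eqxx.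
  by move=> /(_ isT) /esym/eqP.
have [e'0|e'_gt0] := posnP (inv_end_code w' j); first by rewrite e0 e'0.
have := eq_pos (inv_end_code w' j); rewrite e'_gt0 ltnS inv_end_code_le eqxx.
by move=> /(_ isT)/eqP.
Qed.

Lemma vertex_blocksP (x : {ffun simplex_coords N -> R^o}) :
  vertex_blocks x <->
  exists w : 'S_N, intvec R (simplex_of_schubert (schubert_vertex w)) = x.
Proof.
split=> [vx|[w <-] k]; last first.
  have lt_kN : (k.+1 < N)%N by case: (N) k => [|n] [].
  pose j := Ordinal lt_kN.
  have xE (i : 'I_k.+1) :
      block (intvec R (simplex_of_schubert (schubert_vertex w))) k i
      = (inv_end_code w j == i.+1)%:R.
    rewrite [LHS]ffunE intvecE.
    by rewrite simplex_of_schubert_vertex (code_indicatorE w j) /= mulrz_nat.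
  have := inv_end_code_le _ w j; case eq_c: (inv_end_code w j) => [|c] le_c.
    by left; apply/ffunP => i; rewrite xE eq_c ffunE.
  right; exists (Ordinal le_c) => //.
  by apply/ffunP => i; rewrite xE eq_c ffunE eqSS eq_sym.
(* The code to be realized: 0 for the first position, and for position k + 1
   the rank of the basis vector in the k-th block, or 0 if that block is 0. *)
have /choice[m mP] : forall j : 'I_N, exists m, (m <= j)%N /\
    forall u : simplex_coords N, (tag u).+1 = j -> x u = (m == (tagged u).+1)%:R.
  case=> -[|k] lt_j /=; first by exists 0%N.
  have lt_k : (k < N.-1)%N by case: (N) lt_j.
  have tagE (u : simplex_coords N) : (tag u).+1 = k.+1 -> tag u = Ordinal lt_k :> 'I_N.-1.
    by case=> eq_k; apply/val_inj.
  case: (vx (Ordinal lt_k)) => [x0|[i _ xi]].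
    exists 0%N; split=> // -[l n] /=.
    move=> /(tagE (Tagged (fun k : 'I_N.-1 => 'I_k.+1) n)) /= eq_l.
    by subst l; rewrite blockE x0 ffunE.
  exists i.+1; split=> [|[l n]]; first exact: ltn_ord.
  move=> /(tagE (Tagged (fun k : 'I_N.-1 => 'I_k.+1) n)) /= eq_l.
  by subst l; rewrite blockE -xi ffunE eqSS eq_sym.
have [w wE] : exists w : 'S_N, inv_end_code w =1 m.
  by apply: inv_end_code_onto => j; case: (mP j).
exists w; apply/ffunP => u; rewrite intvecE simplex_of_schubert_vertex.
have lt_uN : ((tag u).+1 < N)%N by case: (N) (tag u) => [|n] [].
rewrite (code_indicatorE w (Ordinal lt_uN)) wE mulrz_nat.
by have [_ ->] := mP (Ordinal lt_uN).
Qed.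

Lemma simplex_of_schubert_intvec (z : {ffun schubert_index N -> int}) :
  simplex_of_schubert (intvec R z) = intvec R (simplex_of_schubert z).
Proof. exact: (simplex_of_schubert_map [the {additive int -> R^o} of intr]). Qed.

Lemma simplex_of_schubert_polytope :
  @simplex_of_schubert N R^o @` schubert_polytope R N = simplex_product R N.
Proof.
apply/seteqP; split=> [_ [x Px <-]|].
  have : schubert_polytope R N `<=` @simplex_of_schubert N R^o @^-1` simplex_product R N.
    apply: smallest_sub => [|_ [w _ <-] /=].
      have /convex_setP cQ := @simplex_product_convex R N.
      apply/convex_setP => t y z t0 t1 Qy Qz.
      by rewrite /= linearD !linearZ; apply: cQ.
    rewrite simplex_of_schubert_intvec; apply: vertex_blocks_simplex.
    by apply/vertex_blocksP; exists w.
  exact.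
apply: simplex_product_sub => [|_ /vertex_blocksP[w <-]].
  exact/image_convex_set/convex_hull_convex.
exists (intvec R (schubert_vertex w)); last exact: simplex_of_schubert_intvec.
by apply: sub_gen_smallest; exists w.
Qed.

Lemma schubert_polytope_vertices :
  vertices (schubert_polytope R N) = schubert_vertices R N.
Proof.
apply/seteqP; split=> [|_ [w _ <-]]; first exact: vertices_hull_sub.
apply: (@vertices_linear_preimage _ _ _ (@simplex_of_schubert N R^o)).
- exact: can_inj (@simplex_of_schubertK _ _).
- by apply: sub_gen_smallest; exists w.
rewrite simplex_of_schubert_polytope; apply: vertex_blocks_vertices.
by apply/vertex_blocksP; exists w; apply/esym/simplex_of_schubert_intvec.
Qed.

Lemma schubert_polytope_lattice :
  schubert_polytope R N `&` lattice R (schubert_index N) = schubert_vertices R N.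
Proof.
apply/seteqP; split=> [x [Px [z _ zE]]|_ [w _ <-]]; last first.
  by split; [apply: sub_gen_smallest; exists w|exists (schubert_vertex w)].
subst x.
have Qz : simplex_product R N (intvec R (simplex_of_schubert z)).
  rewrite -simplex_of_schubert_polytope -simplex_of_schubert_intvec.
  by exists (intvec R z).
have /vertex_blocksP[w] : vertex_blocks (intvec R (simplex_of_schubert z)).
  move=> k; have := Qz k.
  have -> : block (intvec R (simplex_of_schubert z)) k =
      intvec R [ffun i => simplex_of_schubert z (Tagged (fun k : 'I_N.-1 => 'I_k.+1) i)].
    by apply/ffunP => i; rewrite [LHS]ffunE !intvecE [in RHS]ffunE.
  exact: std_simplex_lattice.
move=> /intvec_inj/(can_inj (@simplex_of_schubertK _ _)) <-.
by exists w.
Qed.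

Lemma card_schubert_vertices : (schubert_vertices R N #= `I_(N`!))%card.
Proof.
have -> : (N`! = #|{: 'S_N}|)%N by rewrite card_Sn.
apply: (card_eq_trans (inj_card_eq _)).
  by move=> w w' _ _ /intvec_inj/schubert_vertex_inj.
rewrite (card_eqr card_II).
have <- : enum_rank @` [set: 'S_N] = [set: 'I_#|{: 'S_N}|].
  by apply/seteqP; split=> // i _; exists (enum_val i); rewrite ?enum_valK.
by rewrite card_eq_sym; apply: inj_card_eq => w w' _ _ /enum_rank_inj.
Qed.

End Schubert.

Local Open Scope classical_set_scope.

Theorem theorem3p2 (R : realType) (N : nat) (hN : (2 <= N)%N) :
  [/\ unimodularly_equivalent (schubert_polytope R N) (simplex_product R N),
      schubert_polytope R N `&` lattice R (schubert_index N)
        = vertices (schubert_polytope R N),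
      vertices (schubert_polytope R N) = schubert_vertices R N &
      (vertices (schubert_polytope R N) #= `I_(N`!))%card].
Proof.
rewrite schubert_polytope_vertices schubert_polytope_lattice.
split=> //; last exact: card_schubert_vertices.
exists (@simplex_of_schubert N int), (@simplex_of_schubert N R^o); split.
- exists (@schubert_of_simplex N int).
    exact: simplex_of_schubertK.
  exact: schubert_of_simplexK.
- exact: simplex_of_schubert_intvec.
exact: simplex_of_schubert_polytope.
Qed.
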